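(* Let $X$ be a set and let $G$ be a topological subgroup of $\mathrm{Sym}(X)$. Furthermore, let $F \colon \mathbf{I} \to \mathbf{Amen}$ be a functor. Then the following hold. (1) If the action of $G$ on $X$ is extensively amenable, then the topological group $\overline{F}(X) \rtimes G$ is skew-amenable. (2) Suppose that $F$ is tight on $X$. If the topological group $\overline{F}(X) \rtimes G$ is skew-amenable, then the action of $G$ on $X$ is extensively amenable.
   Context: Skew-amenability. For a topological group $G$ and $g\in G$ let $\lambda_g\colon G\to G,\ x\mapsto gx$. Let $\mathrm{LUCB}(G)$ be the algebra of all bounded functions $f\colon G\to\mathbb{R}$ that are left-uniformly continuous, i.e., for every $\epsilon>0$ there is a neighborhood $U$ of the neutral element with $|f(x)-f(y)|\le\epsilon$ whenever $x,y \in G$ and $x^{-1}y\in U$. A mean on a linear subspace $A\subseteq\ell^\infty(Z)$ containing the constant function $\mathbf 1$ ($Z$ a set, $\ell^\infty(Z)$ the bounded real-valued functions) is a positive linear functional $\mu\colon A\to\mathbb{R}$ with $\mu(\mathbf 1)=1$. The group $G$ is skew-amenable if $\mathrm{LUCB}(G)$ admits a mean $\mu$ with $\mu(f\circ\lambda_g)=\mu(f)$ for all $f\in\mathrm{LUCB}(G)$, $g\in G$. $\mathrm{Sym}(X)$ is the group of all permutations of $X$ with the topology of pointwise convergence associated with the discrete topology on $X$; a topological subgroup is a subgroup with the subspace topology. Functors. $\mathbf{I}$ is the category of finite sets with injective maps as morphisms; $\mathbf{Grp}$ is the category of groups and homomorphisms; $\mathbf{Amen}$ is the full subcategory of $\mathbf{Grp}$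 consisting of all amenable (discrete) groups. A functor $F\colon\mathbf{I}\to\mathbf{Grp}$ is extended to a functor $\overline F$ from the category of all sets with injective maps to $\mathbf{Grp}$ by $\overline F(X)=\varinjlim_{Y}F(Y)$, where $Y$ ranges over the finite subsets of $X$, directed by inclusion (with the connecting homomorphisms $F(Y\hookrightarrow Y')$), and with the induced homomorphisms $\overline F(\phi)$ for injective maps $\phi$. $F$ is tight on $X$ if for every $x\in X$ the homomorphism $\overline F(\iota)\colon\overline F(X\setminus\{x\})\to\overline F(X)$ induced by the inclusion $\iota\colon X\setminus\{x\}\to X$ is not surjective. The group $G\leq\mathrm{Sym}(X)$ acts by automorphisms on $\overline F(X)$ via $\tau_g(f)=\overline F(g)(f)$, and this action is continuous for the discrete topology on $\overline F(X)$. $\overline F(X)\rtimes G$ is the semi-direct product with multiplication $(f,g)(f',g')=(f\tau_g(f'),gg')$, endowed with the product of the discrete topology on $\overline F(X)$ and the topology of $G$. Extensive amenability. For a group $H$, $H^{(X)}=\bigoplus_X H$ is the group of finitely supported functions $X\to H$. A group $G$ acting on $X$ acts on $H^{(X)}$ by $(g\boldsymbol{.}f)(x)=f(g^{-1}x)$, and $H^{(X)}\rtimes G$ acts on $H^{(X)}$ by $((f,g),f')\mapsto f\cdot(g\boldsymbol{.}f')$. The action of $G$ on $X$ is extensively amenable if $\ell^\infty((\mathbb{Z}/2\mathbb{Z})^{(X)})$ admits a mean invariant under this action of $(\mathbb{Z}/2\mathbb{Z})^{(X)}\rtimes G$ on $(\mathbb{Z}/2\mathbb{Z})^{(X)}$.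 *)

(* Defs.v *)
From HB Require Import structures.
From mathcomp Require Import all_boot all_order all_algebra.
From mathcomp Require Import finmap generic_quotient.
From mathcomp Require Import all_classical all_reals all_analysis.
Import numFieldNormedType.Exports.
Import Order.TTheory GRing.Theory Num.Theory.

Set Implicit Arguments.
Unset Strict Implicit.
Unset Printing Implicit Defensive.

Local Open Scope classical_set_scope.
Local Open Scope group_scope.

HB.mixin Record isTopologicalGroup T of Group T & Topological T := {
  mulg_continuous : continuous (fun xy : T * T => xy.1 * xy.2) ;
  invg_continuous : continuous (fun x : T => x^-1)
}.

#[short(type="topGroupType")]
HB.structure Definition TopologicalGroup :=
  {T of isTopologicalGroup T & Group T & Topological T}.

Lemma cvg_initial (S : choiceType) (T : topologicalType) (w : S -> T)
    (F : set_system S) (s : S) : Filter F ->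
  F --> (s : initial_topology w) <-> w @ F --> w s.
Proof.
move=> FF; split=> [Fs|wFs U [? /= [[W oW <-]]] /= Ws /filterS].
  by apply: cvg_trans (@initial_continuous S T w s); exact: cvg_app.
by apply; apply: wFs; exact: open_nbhs_nbhs.
Qed.

Section Subgroup.
Variables (T : topGroupType) (S : groupClosed T).

Record subgroup := Subgroup { subgroup_val :> T; _ : subgroup_val \in S }.

HB.instance Definition _ := [isSub for subgroup_val].
HB.instance Definition _ := [Choice of subgroup by <:].

Fact subgroup_closed : group_closed [in S].
Proof.
by split=> [|x y Sx Sy]; rewrite ?gpred1 ?gpredM ?gpredVr.
Qed.

HB.instance Definition _ :=
  SubChoice_isSubGroup.Build _ _ subgroup subgroup_closed.
HB.instance Definition _ :=
  Topological.copy subgroup (initial_topology (val : subgroup -> T)).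

Fact subgroup_mul_continuous :
  continuous (fun xy : subgroup * subgroup => xy.1 * xy.2).
Proof.
have vc : continuous (val : subgroup -> T) by exact: initial_continuous.
apply: (@continuous_comp_initial _ _ T val) => -[x y].
apply: (@continuous2_cvg _ T T T (nbhs (x, y)) _ (fun z => val z.1)
  (fun z => val z.2) (fun a b => a * b) (val x) (val y)).
- exact: (@mulg_continuous T (val x, val y)).
- by apply: (@cvg_comp _ _ _ fst val); [exact: cvg_fst | exact: vc].
- by apply: (@cvg_comp _ _ _ snd val); [exact: cvg_snd | exact: vc].
Qed.

Fact subgroup_inv_continuous : continuous (fun x : subgroup => x^-1).
Proof.
have vc : continuous (val : subgroup -> T) by exact: initial_continuous.
apply: (@continuous_comp_initial subgroup subgroup T val).
rewrite (_ : _ \o _ = (fun z : T => z^-1) \o val).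
  by move=> x; apply: continuous_comp; [exact: vc|exact: invg_continuous].
by apply/funext => z; rewrite /comp gmulfV.
Qed.

HB.instance Definition _ := isTopologicalGroup.Build subgroup
  subgroup_mul_continuous subgroup_inv_continuous.

Definition subgroup_incl : {multiplicative subgroup -> T} := val.

End Subgroup.

Section Means.
Variable R : realType.

(* [mu] is only constrained on the linear subspace [A]; its values outside [A]
   are irrelevant. *)
Definition is_mean (Z : Type) (A : set (Z -> R)) (mu : (Z -> R) -> R) : Prop :=
  [/\ forall (a b : R) (f g : Z -> R), A f -> A g ->
        mu (fun z => a * f z + b * g z)%R = (a * mu f + b * mu g)%R,
      forall f : Z -> R, A f -> (forall z, 0 <= f z)%R -> (0 <= mu f)%R &
      mu (fun=> 1%R) = 1%R].

Definition ell_infty (Z : Type) : set (Z -> R) := bounded_fun.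

Definition LUCB (G : topGroupType) : set (G -> R) :=
  [set f | bounded_fun f /\
     forall e : R, (0 < e)%R -> exists2 U : set G, nbhs (1 : G) U &
       forall x y : G, U (x^-1 * y) -> (`|f x - f y| <= e)%R].

Definition skew_amenable (G : topGroupType) : Prop :=
  exists2 mu : (G -> R) -> R, is_mean (@LUCB G) mu &
    forall (f : G -> R) (g : G), LUCB f -> mu (fun x => f (g * x)) = mu f.

Definition amenable (H : groupType) : Prop :=
  exists2 mu : (H -> R) -> R, is_mean (@ell_infty H) mu &
    forall (f : H -> R) (h : H), ell_infty f -> mu (fun x => f (h * x)) = mu f.

End Means.

Section Sym.
Variable X : choiceType.

Record Sym := MkSym { sym_fun :> X -> X; _ : `[< bijective sym_fun >] }.

HB.instance Definition _ := [isSub for sym_fun].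
HB.instance Definition _ := [Choice of Sym by <:].

Lemma sym_bij (g : Sym) : bijective g.
Proof. by case: g => g /= /asboolP. Qed.

Lemma sym_inj (g : Sym) : injective g.
Proof. exact: bij_inj (sym_bij g). Qed.

Lemma symP (g h : Sym) : g =1 h -> g = h.
Proof. by move=> /funext gh; apply: val_inj. Qed.

Fact sym_one_subproof : `[< bijective (@id X) >].
Proof. by apply/asboolP; exists id. Qed.
Definition sym_one := MkSym sym_one_subproof.

Fact sym_mul_subproof (g h : Sym) : `[< bijective (g \o h) >].
Proof. by apply/asboolP; apply: bij_comp; exact: sym_bij. Qed.
Definition sym_mul g h := MkSym (sym_mul_subproof g h).

Fact sym_inv_ex (g : Sym) : exists f : X -> X, cancel g f /\ cancel f g.
Proof. by have [f gK fK] := sym_bij g; exists f. Qed.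
Definition sym_inv_fun (g : Sym) : X -> X := projT1 (cid (sym_inv_ex g)).
Fact sym_funK (g : Sym) : cancel g (sym_inv_fun g).
Proof. by rewrite /sym_inv_fun; case: cid => f []. Qed.
Fact sym_inv_funK (g : Sym) : cancel (sym_inv_fun g) g.
Proof. by rewrite /sym_inv_fun; case: cid => f []. Qed.
Fact sym_inv_subproof (g : Sym) : `[< bijective (sym_inv_fun g) >].
Proof.
by apply/asboolP; exists g; [exact: sym_inv_funK | exact: sym_funK].
Qed.
Definition sym_inv g := MkSym (sym_inv_subproof g).

Fact sym_mulA : associative sym_mul. Proof. by move=> f g h; apply: symP. Qed.
Fact sym_mul1 : left_id sym_one sym_mul. Proof. by move=> g; exact: symP. Qed.
Fact sym_mulr1 : right_id sym_one sym_mul. Proof. by move=> g; exact: symP. Qed.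
Fact sym_mulV : left_inverse sym_one sym_inv sym_mul.
Proof. by move=> g; apply: symP => x /=; exact: sym_funK. Qed.
Fact sym_mulVr : right_inverse sym_one sym_inv sym_mul.
Proof. by move=> g; apply: symP => x /=; exact: sym_inv_funK. Qed.

HB.instance Definition _ := isGroup.Build Sym
  sym_mulA sym_mul1 sym_mulr1 sym_mulV sym_mulVr.

HB.instance Definition _ := Topological.copy Sym
  (initial_topology (fun g : Sym => (g : {ptws X -> discrete_topology X}))).

Lemma cvg_sym (F : set_system Sym) (g : Sym) : Filter F ->
  F --> g <-> forall x, \forall h \near F, (h : Sym) x = g x.
Proof.
move=> FF; split.
  move/cvg_initial => Fg x.
    have := cvg_comp _ _ Fg
    (@proj_continuous X (fun=> discrete_topology X) x (g : X -> X)).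
  by move=> /(_ [set g x]); apply; exact: discrete_set1.
move=> Fg; apply/cvg_initial/cvg_sup => x; apply/cvg_initial.
by apply: cvg_near_cst; exact: Fg.
Qed.

Fact sym_mul_continuous : continuous (fun gh : Sym * Sym => gh.1 * gh.2).
Proof.
move=> [g h]; apply/cvg_sym => x /=.
have /cvg_sym/(_ (h x)) gx : g --> g by exact: cvg_id.
have /cvg_sym/(_ x) hx : h --> h by exact: cvg_id.
exists ([set k : Sym | k (h x) = g (h x)], [set k : Sym | k x = h x]) => //.
by move=> [k l] /= [<- <-].
Qed.

Fact sym_inv_continuous : continuous (fun g : Sym => g^-1).
Proof.
move=> g; apply/(cvg_sym _ (fmap_filter _ (nbhs_filter g))) => x /=.
have /cvg_sym/(_ (g^-1 x)) : g --> g by exact: cvg_id.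
apply: filterS => h hx /=; apply: (@sym_inj h).
by rewrite hx [LHS]sym_inv_funK [RHS]sym_inv_funK.
Qed.

HB.instance Definition _ := isTopologicalGroup.Build Sym
  sym_mul_continuous sym_inv_continuous.

Lemma symM (g h : Sym) x : (g * h) x = g (h x). Proof. by []. Qed.
Lemma sym1 x : (1 : Sym) x = x. Proof. by []. Qed.
Lemma symK (g : Sym) : cancel g (g^-1)%g. Proof. exact: sym_funK. Qed.
Lemma symVK (g : Sym) : cancel (g^-1)%g g. Proof. exact: sym_inv_funK. Qed.

End Sym.

Record aut_action (N : groupType) (G : topGroupType) := AutAction {
  aut_act :> G -> N -> N;
  aut_actM : forall g, {morph aut_act g : a b / a * b};
  aut_act1 : forall a, aut_act 1 a = a;
  aut_act_comp : forall g h a, aut_act (g * h) a = aut_act g (aut_act h a);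
  aut_act_continuous : continuous
    (fun p : G * discrete_topology N =>
       (aut_act p.1 p.2 : discrete_topology N))
}.

(* The argument [tau] only serves to attach the twisted group law, and the
   product topology with [N] discrete, to the type [N * G]. *)
Definition semidirect (N : groupType) (G : topGroupType)
  (tau : aut_action N G) : Type := (N * G)%type.

Section Semidirect.
Variables (N : groupType) (G : topGroupType) (tau : aut_action N G).
Local Notation NG := (semidirect tau).

HB.instance Definition _ :=
  Topological.copy NG (discrete_topology N * G)%type.

Definition sd_mul (p q : NG) : NG := (p.1 * tau p.2 q.1, p.2 * q.2).
Definition sd_one : NG := (1, 1).
Definition sd_inv (p : NG) : NG := (tau p.2^-1 p.1^-1, p.2^-1).

Fact aut_act_one g : tau g 1 = 1.
Proof. by apply: (mulgI (tau g 1)); rewrite -aut_actM !mulg1. Qed.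

Fact sd_mulA : associative sd_mul.
Proof.
by move=> p q r; rewrite /sd_mul /= aut_actM aut_act_comp !mulgA.
Qed.
Fact sd_mul1 : left_id sd_one sd_mul.
Proof. by case=> a g; rewrite /sd_mul /= aut_act1 !mul1g. Qed.
Fact sd_mulr1 : right_id sd_one sd_mul.
Proof. by case=> a g; rewrite /sd_mul /= aut_act_one !mulg1. Qed.
Fact sd_mulV : left_inverse sd_one sd_inv sd_mul.
Proof.
by case=> a g; rewrite /sd_mul /= -aut_actM !mulVg aut_act_one.
Qed.
Fact sd_mulVr : right_inverse sd_one sd_inv sd_mul.
Proof.
by case=> a g; rewrite /sd_mul /= -aut_act_comp mulgV aut_act1 mulgV.
Qed.

HB.instance Definition _ := isGroup.Build NG
  sd_mulA sd_mul1 sd_mulr1 sd_mulV sd_mulVr.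

Fact nbhs_aut_act (a : N) (g : G) :
  nbhs g [set h : G | tau h a = tau g a].
Proof.
have [[U V] [/= gU aV] UV] :=
  @aut_act_continuous N G tau (g, a) [set tau g a] (discrete_set1 _).
apply: filterS gU => h Uh.
by apply: (UV (h, a)); split => //=; exact: nbhs_singleton aV.
Qed.

Fact sd_mul_continuous : continuous (fun pq : NG * NG => pq.1 * pq.2).
Proof.
move=> [[a g] [b h]] W [[/= U V] [/= aU ghV] UVW].
have [[V1 V2] [/= gV1 hV2] V12] := @mulg_continuous G (g, h) V ghV.
exists ([set p : NG | p.1 = a /\ (V1 p.2 /\ tau p.2 b = tau g b)],
        [set q : NG | q.1 = b /\ V2 q.2]).
  split.
    exists ([set a], V1 `&` [set k | tau k b = tau g b]) => /=.
      by split; [exact: (@discrete_set1 (discrete_topology N))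
                |apply: filterI => //; exact: nbhs_aut_act].
    by move=> [x k] /= [-> [? ?]].
  exists ([set b], V2) => /=.
    by split => //; exact: (@discrete_set1 (discrete_topology N)).
  by move=> [x k] /= [-> ?].
move=> [[x k] [y l]] /= [[-> [V1k kb]] [-> V2l]]; apply: UVW; split => /=.
  rewrite kb; exact: (@nbhs_singleton (discrete_topology N)).
exact: (V12 (k, l)).
Qed.

Fact sd_inv_continuous : continuous (fun p : NG => p^-1).
Proof.
move=> [a g] W [[/= U V] [/= aU gV] UVW].
have := @invg_continuous G g V gV => gV'.
have := @invg_continuous G g _ (nbhs_aut_act a^-1 g^-1) => gact.
exists ([set a], [set h : G | V h^-1] `&`
          [set h : G | tau h^-1 a^-1 = tau g^-1 a^-1]) => /=.
  by split; [exact: (@discrete_set1 (discrete_topology N)) | exact: filterI].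
move=> [x h] /= [-> [Vh hact]]; apply: UVW; split => //=.
rewrite hact; exact: (@nbhs_singleton (discrete_topology N)).
Qed.

HB.instance Definition _ := isTopologicalGroup.Build NG
  sd_mul_continuous sd_inv_continuous.

End Semidirect.

Record inj_functor := InjFunctor {
  fobj :> finType -> groupType;
  fmor : forall (Y Z : finType) (f : Y -> Z), injective f ->
    {multiplicative fobj Y -> fobj Z};
  fmor_id : forall (Y : finType) (i : injective (@id Y)) a, fmor i a = a;
  fmor_comp : forall (Y Z W : finType) (f : Y -> Z) (g : Z -> W)
    (fi : injective f) (gi : injective g) (gfi : injective (g \o f)) a,
    fmor gfi a = fmor gi (fmor fi a)
}.

Section FunctorTheory.
Variable F : inj_functor.

Fact fmor_ext (Y Z : finType) (f f' : Y -> Z) (fi : injective f)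
  (fi' : injective f') a : f =1 f' -> fmor F fi a = fmor F fi' a.
Proof.
by move=> /funext ff'; subst f'; congr (fmor F _ _); exact: Prop_irrelevance.
Qed.

Fact fmor_sq (Y Z Z' W : finType) (f : Y -> Z) (g : Z -> W) (f' : Y -> Z')
    (g' : Z' -> W) (fi : injective f) (gi : injective g)
    (fi' : injective f') (gi' : injective g') a :
  g \o f =1 g' \o f' ->
  fmor F gi (fmor F fi a) = fmor F gi' (fmor F fi' a).
Proof.
move=> e; rewrite -(fmor_comp fi gi (inj_comp gi fi)).
by rewrite -(fmor_comp fi' gi' (inj_comp gi' fi')); exact: fmor_ext.
Qed.

Fact fmor_tri (Y Z W : finType) (f : Y -> Z) (g : Z -> W) (h : Y -> W)
    (fi : injective f) (gi : injective g) (hi : injective h) a :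
  g \o f =1 h -> fmor F gi (fmor F fi a) = fmor F hi a.
Proof.
by move=> e; rewrite -(fmor_comp fi gi (inj_comp gi fi)); exact: fmor_ext.
Qed.

Definition fmor_incl (X : choiceType) (Y Z : {fset X}) (s : (Y `<=` Z)%fset) :
  {multiplicative F Y -> F Z} := fmor F (@fincl_inj X Y Z s).

End FunctorTheory.

Section Colimit.
Variables (F : inj_functor) (X : choiceType).

Definition precolim : Type := {Y : {fset X} & F Y}.
HB.instance Definition _ := Choice.copy precolim {Y : {fset X} & F Y}.

Definition colim_rel (u v : precolim) : bool :=
  `[< exists Z (s : (tag u `<=` Z)%fset) (t : (tag v `<=` Z)%fset),
        fmor_incl F s (tagged u) = fmor_incl F t (tagged v) >].

Fact fmor_incl_comp (Y Z W : {fset X}) (s : (Y `<=` Z)%fset) (t : (Z `<=` W)%fset)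
  (st : (Y `<=` W)%fset) a : fmor_incl F t (fmor_incl F s a) = fmor_incl F st a.
Proof. by apply: fmor_tri => y; exact: val_inj. Qed.

Fact fmor_incl_irr (Y Z : {fset X}) (s t : (Y `<=` Z)%fset) a :
  fmor_incl F s a = fmor_incl F t a.
Proof. by apply: fmor_ext => y; exact: val_inj. Qed.

Fact colim_rel_refl : reflexive colim_rel.
Proof. by move=> u; apply/asboolP;
  exists (tag u), (fsubset_refl _), (fsubset_refl _). Qed.

Fact colim_rel_sym : symmetric colim_rel.
Proof.
by move=> u v; apply/asboolP/asboolP => -[Z [s [t e]]]; exists Z, t, s.
Qed.

Fact colim_rel_trans : transitive colim_rel.
Proof.
move=> v u w /asboolP[Z [s [t e]]] /asboolP[Z' [t' [r e']]]; apply/asboolP.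
have sZ := fsubsetUl Z Z'; have sZ' := fsubsetUr Z Z'.
exists (Z `|` Z')%fset, (fsubset_trans s sZ), (fsubset_trans r sZ').
rewrite -(fmor_incl_comp s sZ) -(fmor_incl_comp r sZ') e -e'.
by rewrite !(fmor_incl_comp _ _ (fsubset_trans t sZ)).
Qed.

Canonical colim_equiv :=
  EquivRel colim_rel colim_rel_refl colim_rel_sym colim_rel_trans.

Definition colim : Type := {eq_quot colim_rel}%qT.
HB.instance Definition _ := Choice.on colim.

Definition colim_in (Y : {fset X}) (a : F Y) : colim :=
  (\pi_({eq_quot colim_rel}) (existT (fun Y : {fset X} => F Y) Y a))%qT.

Fact colim_in_eq (Y Z : {fset X}) (a : F Y) (b : F Z) :
  colim_in a = colim_in b <->
  exists W (s : (Y `<=` W)%fset) (t : (Z `<=` W)%fset),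
    fmor_incl F s a = fmor_incl F t b.
Proof.
split=> [/eqmodP/asboolP //|ab].
by apply/eqmodP/asboolP.
Qed.

Lemma colim_in_incl (Y Z : {fset X}) (s : (Y `<=` Z)%fset) (a : F Y) :
  colim_in (fmor_incl F s a) = colim_in a.
Proof.
apply/colim_in_eq; exists Z, (fsubset_refl Z), s.
exact: fmor_incl_comp.
Qed.

Fact colim_reprE (u : colim) :
  u = colim_in (tagged (repr (u : {eq_quot colim_rel}%qT))).
Proof.
rewrite /colim_in -[LHS](@reprK _ {eq_quot colim_rel}%qT); congr (\pi _)%qT.
by case: (repr _).
Qed.

Lemma colim_inP (u : colim) : exists (Y : {fset X}) (a : F Y), u = colim_in a.
Proof. by do 2!eexists; exact: colim_reprE. Qed.

Lemma colim_in2P (u v : colim) :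
  exists (Y : {fset X}) (a b : F Y), u = colim_in a /\ v = colim_in b.
Proof.
have [[Y [a ->]] [Z [b ->]]] := (colim_inP u, colim_inP v).
exists (Y `|` Z)%fset, (fmor_incl F (fsubsetUl Y Z) a).
by exists (fmor_incl F (fsubsetUr Y Z) b); rewrite !colim_in_incl.
Qed.

Definition colim_mul (u v : colim) : colim :=
  let p := repr (u : {eq_quot colim_rel}%qT) in
  let q := repr (v : {eq_quot colim_rel}%qT) in
  colim_in (fmor_incl F (fsubsetUl (tag p) (tag q)) (tagged p) *
            fmor_incl F (fsubsetUr (tag p) (tag q)) (tagged q)).

Definition colim_one : colim := colim_in (1 : F fset0).

Definition colim_inv (u : colim) : colim :=
  colim_in (tagged (repr (u : {eq_quot colim_rel}%qT)))^-1.

Fact fmor_one (Y Z : finType) (f : Y -> Z) (fi : injective f) :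
  fmor F fi 1 = 1.
Proof. by apply: (mulgI (fmor F fi 1)); rewrite -gmulfM !mulg1. Qed.

Fact fmor_inv (Y Z : finType) (f : Y -> Z) (fi : injective f) a :
  fmor F fi a^-1 = (fmor F fi a)^-1.
Proof.
by apply: (mulgI (fmor F fi a)); rewrite -gmulfM !mulgV fmor_one.
Qed.

Fact colim_in_mul (Y : {fset X}) (a b : F Y) :
  colim_mul (colim_in a) (colim_in b) = colim_in (a * b).
Proof.
rewrite /colim_mul.
have := colim_reprE (colim_in a); have := colim_reprE (colim_in b).
case: (repr (colim_in a : {eq_quot _}%qT)) => Z c /=.
case: (repr (colim_in b : {eq_quot _}%qT)) => W d /=.
move=> /colim_in_eq [V [s [t e]]] /colim_in_eq [V' [s' [t' e']]].
apply/colim_in_eq.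
have VU := fsubsetUl V V'; have V'U := fsubsetUr V V'.
have ZWU : (Z `|` W `<=` V `|` V')%fset.
  by rewrite fsubUset (fsubset_trans t' V'U) (fsubset_trans t VU).
exists (V `|` V')%fset, ZWU, (fsubset_trans s VU).
rewrite !gmulfM; congr (_ * _).
  rewrite (fmor_incl_comp _ _ (fsubset_trans t' V'U)) -(fmor_incl_comp t' V'U).
  rewrite -e' (fmor_incl_comp _ _ (fsubset_trans s' V'U)).
  exact: fmor_incl_irr.
rewrite (fmor_incl_comp _ _ (fsubset_trans t VU)) -(fmor_incl_comp t VU).
by rewrite -e (fmor_incl_comp _ _ (fsubset_trans s VU)).
Qed.

Fact colim_in_one (Y : {fset X}) : colim_in (1 : F Y) = colim_one.
Proof.
by rewrite /colim_one -(colim_in_incl (fsub0set Y) 1) /fmor_incl fmor_one.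
Qed.

Fact colim_in_inv (Y : {fset X}) (a : F Y) :
  colim_inv (colim_in a) = colim_in a^-1.
Proof.
rewrite /colim_inv; have := colim_reprE (colim_in a).
case: (repr (colim_in a : {eq_quot _}%qT)) => Z c /=.
move=> /colim_in_eq [V [s [t e]]]; apply/colim_in_eq; exists V, t, s.
by rewrite /fmor_incl !fmor_inv; congr (_^-1).
Qed.

Fact colim_mulA : associative colim_mul.
Proof.
move=> u v w; have [Y [a [b [-> ->]]]] := colim_in2P u v.
have [Z [c ->]] := colim_inP w.
rewrite -(colim_in_incl (fsubsetUl Y Z) a) -(colim_in_incl (fsubsetUl Y Z) b).
by rewrite -(colim_in_incl (fsubsetUr Y Z) c) !colim_in_mul mulgA.
Qed.
Fact colim_mul1 : left_id colim_one colim_mul.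
Proof.
by move=> u; have [Y [a ->]] := colim_inP u;
  rewrite -(colim_in_one Y) colim_in_mul mul1g.
Qed.
Fact colim_mulr1 : right_id colim_one colim_mul.
Proof.
by move=> u; have [Y [a ->]] := colim_inP u;
  rewrite -(colim_in_one Y) colim_in_mul mulg1.
Qed.
Fact colim_mulV : left_inverse colim_one colim_inv colim_mul.
Proof.
by move=> u; have [Y [a ->]] := colim_inP u;
  rewrite colim_in_inv colim_in_mul mulVg colim_in_one.
Qed.
Fact colim_mulVr : right_inverse colim_one colim_inv colim_mul.
Proof.
by move=> u; have [Y [a ->]] := colim_inP u;
  rewrite colim_in_inv colim_in_mul mulgV colim_in_one.
Qed.

HB.instance Definition _ := isGroup.Build colim
  colim_mulA colim_mul1 colim_mulr1 colim_mulV colim_mulVr.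

Lemma colim_inM (Y : {fset X}) : {morph @colim_in Y : a b / a * b}.
Proof. by move=> a b; rewrite -colim_in_mul. Qed.

End Colimit.

Section ColimitMap.
Variable F : inj_functor.

Section Map.
Variables (X X' : choiceType) (phi : X -> X') (phi_inj : injective phi).

Definition fset_restr (Y : {fset X}) (y : Y) : (phi @` Y)%fset :=
  [` in_imfset imfset_key phi (valP y)]%fset.

Fact fset_restr_inj (Y : {fset X}) : injective (@fset_restr Y).
Proof. by move=> y z /(congr1 val) /= /phi_inj /val_inj. Qed.

Fact fset_img_sub (Y Z : {fset X}) :
  (Y `<=` Z)%fset -> (phi @` Y `<=` phi @` Z)%fset.
Proof.
move=> /fsubsetP YZ; apply/fsubsetP => _ /imfsetP [y /= Yy ->].
by rewrite in_imfset //; exact: YZ.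
Qed.

Definition colim_map (u : colim F X) : colim F X' :=
  let p := repr (u : {eq_quot colim_rel (F := F) (X := X)}%qT) in
  colim_in (fmor F (@fset_restr_inj (tag p)) (tagged p)).

Lemma colim_map_in (Y : {fset X}) (a : F Y) :
  colim_map (colim_in a) = colim_in (fmor F (@fset_restr_inj Y) a).
Proof.
rewrite /colim_map; have := colim_reprE (colim_in a).
case: (repr _) => Z c /= /colim_in_eq [V [s [t e]]].
apply/colim_in_eq.
have t' := fset_img_sub t.
have s' := fset_img_sub s.
exists (phi @` V)%fset, t', s'.
transitivity (fmor F (@fset_restr_inj V) (fmor_incl F t c)).
  by apply: fmor_sq => y; exact: val_inj.
by rewrite -e; apply: fmor_sq => y; exact: val_inj.
Qed.

Fact colim_mapM : {morph colim_map : u v / u * v}.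
Proof.
move=> u v; have [Y [a [b [-> ->]]]] := colim_in2P u v.
by rewrite -colim_inM !colim_map_in gmulfM colim_inM.
Qed.

HB.instance Definition _ :=
  isMultiplicative.Build (colim F X) (colim F X') colim_map colim_mapM.

End Map.

Lemma colim_map_eq (X X' : choiceType) (phi psi : X -> X')
    (phi_inj : injective phi) (psi_inj : injective psi) (Y : {fset X})
    (a : F Y) :
  {in Y, phi =1 psi} ->
  colim_map phi_inj (colim_in a) = colim_map psi_inj (colim_in a).
Proof.
move=> e; rewrite !colim_map_in; apply/colim_in_eq.
have s : (psi @` Y `<=` phi @` Y)%fset.
  by apply/fsubsetP => _ /imfsetP [y /= Yy ->]; rewrite -e // in_imfset.
exists (phi @` Y)%fset, (fsubset_refl _), s.
by apply: fmor_sq => y; apply: val_inj => /=; exact: e (valP y).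
Qed.

Lemma colim_map_id (X : choiceType) (i : injective (@id X)) (u : colim F X) :
  colim_map i u = u.
Proof.
have [Y [a ->]] := colim_inP u; rewrite colim_map_in; apply/colim_in_eq.
have s : (id @` Y `<=` Y)%fset by rewrite imfset_id.
exists Y, s, (fsubset_refl _).
by apply: fmor_tri => y; exact: val_inj.
Qed.

Lemma colim_map_comp (X X' X'' : choiceType) (phi : X -> X') (psi : X' -> X'')
    (phi_inj : injective phi) (psi_inj : injective psi)
    (comp_inj : injective (psi \o phi)) (u : colim F X) :
  colim_map comp_inj u = colim_map psi_inj (colim_map phi_inj u).
Proof.
have [Y [a ->]] := colim_inP u; rewrite !colim_map_in; apply/colim_in_eq.
have s : ((psi \o phi) @` Y `<=` psi @` (phi @` Y))%fset.
  by rewrite imfset_comp.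
exists (psi @` (phi @` Y))%fset, s, (fsubset_refl _).
rewrite -(fmor_comp _ _ (inj_comp (@fset_restr_inj _ _ _ psi_inj _)
  (@fset_restr_inj _ _ _ phi_inj Y))).
by apply: fmor_sq => y; exact: val_inj.
Qed.

Fact setD1_inj (X : choiceType) (x : X) :
  injective (val : {y : X | y != x} -> X).
Proof. exact: val_inj. Qed.

Definition tight (X : choiceType) : Prop :=
  forall x : X,
    ~ (forall u : colim F X, exists v, colim_map (@setD1_inj X x) v = u).

End ColimitMap.

Section ColimitAction.
Variables (F : inj_functor) (X : choiceType) (G : groupClosed (Sym X)).

Definition colim_act (g : subgroup G) : colim F X -> colim F X :=
  colim_map (@sym_inj X (val g)).

Fact colim_actM g : {morph colim_act g : a b / a * b}.
Proof. exact: colim_mapM. Qed.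
Fact colim_act1 a : colim_act 1 a = a.
Proof. exact: colim_map_id. Qed.
Fact colim_act_comp g h a : colim_act (g * h) a = colim_act g (colim_act h a).
Proof. exact: colim_map_comp. Qed.

Fact colim_act_continuous : continuous
  (fun p : subgroup G * discrete_topology (colim F X) =>
     (colim_act p.1 p.2 : discrete_topology (colim F X))).
Proof.
move=> [g u]; apply: cvg_near_cst.
have [Y [a ua]] := colim_inP u.
pose P (y : Y) := [set h : subgroup G |
  (subgroup_val h : Sym X) (val y) = (subgroup_val g : Sym X) (val y)].
have gY : \forall h \near g, forall y : Y, P y h.
  apply: (@filter_forall _ Y P _ (nbhs_filter g)) => y.
  have /cvg_sym/(_ (val y)) : nbhs (subgroup_val g : Sym X) -->
    (subgroup_val g : Sym X) by exact: cvg_id.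
  exact: (@initial_continuous (subgroup G) (Sym X) (@subgroup_val _ G) g).
exists ([set h | forall y : Y, P y h], [set u]) => /=.
  by split => //; exact: (@discrete_set1 (discrete_topology _)).
move=> [h v] /= [hY ->]; rewrite ua; apply: colim_map_eq => y yY.
exact: (hY [` yY]%fset).
Qed.

Definition colim_action : aut_action (colim F X) (subgroup G) :=
  AutAction colim_actM colim_act1 colim_act_comp colim_act_continuous.

End ColimitAction.

Section ExtensiveAmenability.
Variable X : choiceType.

Section Finsupp.
Variable H : groupType.
Local Notation HX := {fsfun X -> H with (1 : H)}.

Definition fsfun_mul (f f' : HX) : HX :=
  [fsfun x in (finsupp f `|` finsupp f')%fset => f x * f' x | 1].

Lemma fsfun_mulE (f f' : HX) x : fsfun_mul f f' x = f x * f' x.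
Proof.
rewrite fsfunE in_fsetU; case: ifPn => //.
by rewrite negb_or => /andP[/fsfun_dflt -> /fsfun_dflt ->]; rewrite mulg1.
Qed.

Definition fsfun_shift (g : Sym X) (f : HX) : HX :=
  [fsfun x in (g @` finsupp f)%fset => f ((g^-1)%g x) | 1].

Lemma fsfun_shiftE (g : Sym X) (f : HX) x :
  fsfun_shift g f x = f ((g^-1)%g x).
Proof.
rewrite fsfunE; case: ifPn => // xg; rewrite fsfun_dflt //.
by apply: contra xg => xf; apply/imfsetP; exists ((g^-1)%g x); rewrite ?symVK.
Qed.

End Finsupp.

(* The action of [G] on [X] is given as a homomorphism to the group of
   permutations of [X]. The group law of the groupType ['Z_2] is addition, so
   its [1] is the zero of Z/2Z. *)
Definition extensively_amenable (R : realType) (G : groupType)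
    (rho : {multiplicative G -> Sym X}) : Prop :=
  let Z2X := {fsfun X -> 'Z_2 with (1 : 'Z_2)} in
  exists2 mu : (Z2X -> R) -> R, is_mean (@ell_infty R Z2X) mu &
    forall (k : Z2X -> R) (f : Z2X) (g : G), ell_infty k ->
      mu (fun f' => k (fsfun_mul f (fsfun_shift (rho g) f'))) = mu k.

End ExtensiveAmenability.

(* Main.v *)
Require Import Defs.
From mathcomp Require Import all_boot all_order all_algebra.
From mathcomp Require Import finmap.
From mathcomp Require Import all_classical all_reals all_analysis.
From mathcomp Require Import lra.
Import numFieldNormedType.Exports.
Import Order.TTheory GRing.Theory Num.Theory.

Set Implicit Arguments.
Unset Strict Implicit.
Unset Printing Implicit Defensive.

Local Open Scope classical_set_scope.
Local Open Scope ring_scope.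

(** A mean [m] on the bounded functions of a finite subset of [X] is called
    exhausting when it is [G]-invariant and does not see the values of a
    function at sets failing to contain a prescribed finite set: an [m]-random
    finite set [E] contains every given finite set almost surely.  The theorem
    holds because extensive amenability is equivalent to the existence of such
    an [m], which implies skew-amenability and, under tightness, follows from
    it.

    An exhausting mean can be produced from any invariant mean for which the
    random set [E] misses each point with probability at most 1/2
    ([ex_exhausting_mean]): the union of [n] independent copies of [E] misses a
    point with probability at most [2^-n], and one passes to the limit in [n]
    along an ultrafilter.

    Extensive amenability ([extensively_amenableP]).  An invariant mean on
    (Z/2)^(X), pushed forward by the support map, misses each point with
    probability at most 1/2, since toggling a coordinate preserves the mean.
    Conversely, choosing [E] at random and then a uniform function supported in
    [E] gives a mean invariant under [G], and under translation by [f] because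
    [E] almost surely contains the support of [f].

    From skew-amenability to an exhausting mean ([tight_exhausting_mean]).
    Functions on the semidirect product [N ><| G] that factor through the
    discrete group [N = F(X)] are left-uniformly continuous, whence a mean on
    [N] invariant under translations and under [G].  Let the support of [u] in
    [N] consist of the [x] for which [u] does not come from [X \ {x}]. It is a
    finite set depending equivariantly on [u].  Its missing [x] means that [u]
    lies in a subgroup which is proper by tightness, hence has measure at most
    1/2, being disjoint from one of its translates.

    From an exhausting mean to skew-amenability ([skew_amenable_of_exhausting]).
    Choose independently two [m]-random finite sets [D] and [E]; choose a
    uniform element among the finitely many injections from [D] to [E] that are
    restrictions of elements of [G], extend it to some [g] in [G]; and choose
    [u] in [N] by a translation-invariant mean on [F(E)], made equivariant in [E]
    by averaging over the enumerations of [E].  The law of [(u, g)] gives an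
    invariant mean on left-uniformly continuous functions.  Left-translating by [(a, h)] replaces [E] by [hE], which has the same
    law and almost surely supports [a], and it changes the extension [g] only
    by an element fixing [D] pointwise; as [D] is almost surely large, a
    left-uniformly continuous function does not notice the latter. *)

(** * Means on bounded functions *)

Section BoundedFunctions.
Variable R : realType.

Lemma ell_inftyP (Z : Type) (f : Z -> R) :
  ell_infty f <-> exists c, forall z, `|f z| <= c.
Proof.
split=> [[c [_ fc]]|[c fc]].
  by exists (c + 1) => z; apply: (fc (c + 1)) => //; rewrite ltrDl.
by exists c; split=> [|d cd z _]; [exact: num_real | exact: le_trans (ltW cd)].
Qed.

Lemma ell_infty_cst {Z : Type} (a : R) : ell_infty (fun _ : Z => a).
Proof. by apply/ell_inftyP; exists `|a|. Qed.

Lemma ell_infty_comp (Z W : Type) (p : Z -> W) (f : W -> R) :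
  ell_infty f -> ell_infty (fun z => f (p z)).
Proof. by move=> /ell_inftyP[c fc]; apply/ell_inftyP; exists c. Qed.

Lemma ell_infty_lin (Z : Type) (a b : R) (f g : Z -> R) :
  ell_infty f -> ell_infty g -> ell_infty (fun z => a * f z + b * g z).
Proof.
move=> /ell_inftyP[c fc] /ell_inftyP[d gd]; apply/ell_inftyP.
exists (`|a| * c + `|b| * d) => z; apply: (le_trans (ler_normD _ _)).
by rewrite !normrM lerD // ler_wpM2l.
Qed.

Lemma ell_inftyD (Z : Type) (f g : Z -> R) :
  ell_infty f -> ell_infty g -> ell_infty (fun z => f z + g z).
Proof.
move=> bf bg; have := ell_infty_lin 1 1 bf bg.
by congr ell_infty; apply/funext => z; rewrite !mul1r.
Qed.

Lemma ell_inftyB (Z : Type) (f g : Z -> R) :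
  ell_infty f -> ell_infty g -> ell_infty (fun z => f z - g z).
Proof.
move=> bf bg; have := ell_infty_lin 1 (-1) bf bg.
by congr ell_infty; apply/funext => z; rewrite mul1r mulN1r.
Qed.

Lemma ell_infty_indic (Z : Type) (P : pred Z) :
  ell_infty (fun z => (P z)%:R : R).
Proof. by apply/ell_inftyP; exists 1 => z; case: (P z); rewrite ?normr1 ?normr0. Qed.

Section MeanTheory.
Variables (Z : Type) (mu : (Z -> R) -> R).
Hypothesis mu_mean : is_mean (@ell_infty R Z) mu.

Lemma mean_cst (a : R) : mu (fun=> a) = a.
Proof.
have [lin _ one] := mu_mean.
have := lin a 0 _ _ (ell_infty_cst 1) (ell_infty_cst 1).
by rewrite one mul0r addr0 !mulr1.
Qed.

Lemma meanD (f g : Z -> R) : ell_infty f -> ell_infty g ->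
  mu (fun z => f z + g z) = mu f + mu g.
Proof.
have [lin _ _] := mu_mean => bf bg; have := lin 1 1 _ _ bf bg.
by rewrite !mul1r => <-; congr mu; apply/funext => z; rewrite !mul1r.
Qed.

Lemma meanB (f g : Z -> R) : ell_infty f -> ell_infty g ->
  mu (fun z => f z - g z) = mu f - mu g.
Proof.
have [lin _ _] := mu_mean => bf bg; have := lin 1 (-1) _ _ bf bg.
by rewrite mul1r mulN1r => <-; congr mu; apply/funext => z; rewrite mul1r mulN1r.
Qed.

Lemma le_mean (f g : Z -> R) : ell_infty f -> ell_infty g ->
  (forall z, f z <= g z) -> mu f <= mu g.
Proof.
have [_ pos _] := mu_mean => bf bg fg.
by rewrite -subr_ge0 -meanB //; apply: pos => [|z];
  [exact: ell_inftyB | rewrite subr_ge0].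
Qed.

Lemma le_norm_mean (f : Z -> R) (c : R) :
  (forall z, `|f z| <= c) -> `|mu f| <= c.
Proof.
move=> fc; have bf : ell_infty f by apply/ell_inftyP; exists c.
by rewrite ler_norml -{1}(mean_cst (- c)) -{2}(mean_cst c) !le_mean //;
  do ?[exact: ell_infty_cst | move=> z; have := fc z; rewrite ler_norml => /andP[]].
Qed.

End MeanTheory.

Lemma mean_push (Z W : Type) (A : set (Z -> R)) (mu : (Z -> R) -> R)
    (p : Z -> W) :
  is_mean A mu -> (forall k, ell_infty k -> A (k \o p)) ->
  is_mean (@ell_infty R W) (fun k => mu (k \o p)).
Proof.
move=> [lin pos one] Ap; split => //.
- by move=> a b f g bf bg; exact: lin (Ap _ bf) (Ap _ bg).
- by move=> f bf f0; apply: pos; [exact: Ap | move=> z; exact: f0].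
Qed.

(** Means are contractions, so a uniformly bounded family of integrands gives a
    bounded function of the parameter even when the integrand varies with it. *)
Lemma ell_infty_mean (Z W : Type) (M : Z -> (W -> R) -> R) (k : Z -> W -> R) :
  (forall z, is_mean (@ell_infty R W) (M z)) ->
  (exists c, forall z w, `|k z w| <= c) ->
  ell_infty (fun z => M z (k z)).
Proof.
by move=> mM [c kc]; apply/ell_inftyP; exists c => z; exact: le_norm_mean.
Qed.

Lemma ell_infty_mean1 (Z W : Type) (M : Z -> (W -> R) -> R) (k : W -> R) :
  (forall z, is_mean (@ell_infty R W) (M z)) ->
  ell_infty k -> ell_infty (fun z => M z k).
Proof.
by move=> mM /ell_inftyP[c kc]; apply: ell_infty_mean => //; exists c.
Qed.

(** Two-stage random choice: [z] by [mu], then [w] by [M z].  No measurability is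
    involved, as the means are defined on all bounded functions. *)
Lemma mean_bind (Z W : Type) (mu : (Z -> R) -> R) (M : Z -> (W -> R) -> R) :
  is_mean (@ell_infty R Z) mu -> (forall z, is_mean (@ell_infty R W) (M z)) ->
  is_mean (@ell_infty R W) (fun k => mu (fun z => M z k)).
Proof.
move=> mmu mM; have [lin pos one] := mmu; split.
- move=> a b f g bf bg; rewrite -lin; try by apply: ell_infty_mean1.
  by congr mu; apply/funext => z; have [linz _ _] := mM z; rewrite linz.
- move=> f bf f0; apply: pos => [|z]; first exact: ell_infty_mean1.
  by have [_ pz _] := mM z; exact: pz.
- by rewrite -[RHS]one; congr mu; apply/funext => z; have [_ _ ->] := mM z.
Qed.

Lemma mean_dirac (Z : Type) (z : Z) : is_mean (@ell_infty R Z) (fun k => k z).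
Proof. by split. Qed.

End BoundedFunctions.

Section Averages.
Variable R : realType.

Definition avg (T : Type) (s : seq T) (f : T -> R) : R :=
  (\sum_(x <- s) f x) / (size s)%:R.

Lemma avg_mean (T : Type) (s : seq T) :
  (0 < size s)%N -> is_mean (@ell_infty R T) (avg s).
Proof.
move=> s0; split.
- move=> a b f g _ _.
  by rewrite /avg big_split /= -!mulr_sumr mulrDl !mulrA.
- by move=> f _ f0; rewrite /avg divr_ge0 // sumr_ge0.
- rewrite /avg big_const_seq count_predT iter_addr addr0 divff //.
  by rewrite pnatr_eq0 -lt0n.
Qed.

Lemma eq_avg (T : eqType) (s : seq T) (f g : T -> R) :
  {in s, f =1 g} -> avg s f = avg s g.
Proof. by move=> fg; congr (_ / _); exact: eq_big_seq. Qed.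

(** Every equivariance of a uniform measure below is an instance: [h] matches the
    two finite sets listed by [s] and [t]. *)
Lemma avg_inj (S T : eqType) (s : seq S) (t : seq T) (h : S -> T)
    (f : T -> R) :
  uniq s -> uniq t -> injective h ->
  (forall y, (y \in t) = (y \in map h s)) ->
  avg s (fun x => f (h x)) = avg t f.
Proof.
move=> us ut hi ts.
have st : perm_eq t (map h s) by rewrite uniq_perm // map_inj_uniq.
by rewrite /avg (perm_big _ st) (perm_size st) size_map big_map.
Qed.

Lemma avg_close (T : eqType) (s : seq T) (f h : T -> R) e :
  (0 < size s)%N -> {in s, forall x, `|f x - h x| <= e} ->
  `|avg s f - avg s h| <= e.
Proof.
move=> s0 fh; rewrite /avg -mulrBl -sumrB normrM normfV normr_nat.
rewrite ler_pdivrMr ?ltr0n //.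
apply: (le_trans (ler_norm_sum _ _ _)).
rewrite big_seq; apply: (le_trans (ler_sum _ fh)).
by rewrite -big_seq big_const_seq count_predT iter_addr addr0 mulr_natr.
Qed.

End Averages.

(** * A limit functional *)

(** The limit along an ultrafilter on the integers: bounded functions have a
    cluster value by compactness of segments, and an ultrafilter converges to
    each of its cluster points. *)
Lemma ex_limit_mean (R : realType) : exists2 L : (nat -> R) -> R,
  is_mean (@ell_infty R nat) L &
  forall k c, ell_infty k -> (\forall n \near \oo, k n <= c) -> L k <= c.
Proof.
have [U [UU oU]] := ultraFilterLemma (@eventually_filter).
have PU : ProperFilter U by exact: ultra_proper.
have kcvg (k : nat -> R) : ell_infty k -> cvg (k @ U).
  move=> /ell_inftyP[c kc].
  have kcc : (k @ U) `[- c, c]%classic.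
    by apply: (@filterE _ U) => n /=; rewrite in_itv /= -ler_norml.
  have [l [_ lU]] := @segment_compact R (- c) c (k @ U) _ kcc.
  apply/cvg_ex; exists l => B Bl.
  case: (in_ultra_setVsetC (k @^-1` B) UU) => // UB.
  by have [x [nBx Bx]] := lU (~` B) B UB Bl.
exists (fun k => lim (k @ U)).
  split=> [a b f g /kcvg cf /kcvg cg|f /kcvg cf f0|].
  - apply/cvg_lim => //; apply: cvgD; apply: cvgMr; assumption.
  - by apply: limr_ge => //; exact: nearW.
  - exact: lim_cst.
move=> k c /kcvg ck kc; apply: limr_le => //; exact: oU.
Qed.

(** * Exhausting means on the finite subsets *)

Section Exhausting.
Variables (R : realType) (X : choiceType) (G : groupClosed (Sym X)).
Implicit Types (E Y : {fset X}) (g : subgroup G).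

Lemma mem_sym_imfset (g : Sym X) E x :
  (x \in (g @` E)%fset) = ((g^-1)%g x \in E).
Proof. by rewrite -{1}(symVK g x) (mem_imfset imfset_key (mem E) (@sym_inj X g)). Qed.

Lemma sym_imfset_sub (g : Sym X) Y E :
  (Y `<=` g @` E)%fset = ((g^-1)%g @` Y `<=` E)%fset.
Proof.
apply/fsubsetP/fsubsetP => YE x.
  by rewrite mem_sym_imfset => /YE; rewrite mem_sym_imfset symVK.
move=> Yx; rewrite mem_sym_imfset; apply: YE.
by rewrite mem_sym_imfset symK.
Qed.

Definition fset_invariant (m : ({fset X} -> R) -> R) : Prop :=
  forall g k, ell_infty k -> m (fun E => k (val g @` E)%fset) = m k.

Definition exhausting_mean (m : ({fset X} -> R) -> R) : Prop :=
  [/\ is_mean (@ell_infty R {fset X}) m, fset_invariant m &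
      forall Y k, ell_infty k ->
        (forall E, (Y `<=` E)%fset -> k E = 0) -> m k = 0].

(** Two integrands close to each other on the sets containing [Y] can be made
    close everywhere by altering them on an [m]-null family of sets. *)
Lemma exhausting_close m Y k l e : exhausting_mean m ->
  ell_infty k -> ell_infty l -> 0 <= e ->
  (forall E, (Y `<=` E)%fset -> `|k E - l E| <= e) -> `|m k - m l| <= e.
Proof.
move=> [mm _ mY] bk bl e0 kl; rewrite -(meanB mm bk bl).
pose h E := if (Y `<=` E)%fset then k E - l E else 0.
have he E : `|h E| <= e.
  by rewrite /h; case: ifP => YE; [exact: kl | rewrite normr0].
have bh : ell_infty h by apply/ell_inftyP; exists e.
rewrite (_ : m _ = m h); first exact: le_norm_mean.
apply/eqP; rewrite -subr_eq0 -(meanB mm (ell_inftyB bk bl) bh).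
apply/eqP; apply: (mY Y) => [|E YE].
  exact: ell_inftyB (ell_inftyB bk bl) bh.
by rewrite /h YE subrr.
Qed.

Lemma exhausting_eq m Y k l : exhausting_mean m ->
  ell_infty k -> ell_infty l ->
  (forall E, (Y `<=` E)%fset -> k E = l E) -> m k = m l.
Proof.
move=> em bk bl kl; apply/eqP; rewrite -subr_eq0 -normr_le0.
by apply: (exhausting_close (Y := Y) em) => // E /kl ->; rewrite subrr normr0.
Qed.

Definition misses (x : X) E : R := (x \notin E)%:R.

Lemma ell_infty_misses x : ell_infty (misses x).
Proof. exact: ell_infty_indic. Qed.

(** A set not containing [Y] misses one of the finitely many points of [Y], so the
    union bound reduces the claim to single points. *)
Lemma exhausting_of_points m :
  is_mean (@ell_infty R {fset X}) m -> fset_invariant m ->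
  (forall x, m (misses x) = 0) -> exhausting_mean m.
Proof.
move=> mm mi m0; split=> // Y k bk kY.
pose h E : R := \sum_(x <- Y) misses x E.
have [bh mh] : ell_infty h /\ m h = 0.
  rewrite /h; elim: (enum_fset Y) => [|x s [bs ms]].
    have -> : (fun E => \sum_(x <- [::]) misses x E) = (fun=> 0).
      by apply/funext => E; rewrite big_nil.
    by split; [exact: ell_infty_cst | exact: (mean_cst mm)].
  have -> : (fun E => \sum_(y <- x :: s) misses y E) =
            (fun E => 1 * misses x E + 1 * \sum_(y <- s) misses y E).
    by apply/funext => E; rewrite big_cons !mul1r.
  have bx := ell_infty_misses x.
  split; first exact: ell_infty_lin.
  by have [lin _ _] := mm; rewrite lin // m0 ms !mulr0 addr0.
(* [h E] counts the points of [Y] outside [E]; [c * h] dominates [k] and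
   has mean 0. *)
have [c kc] := (ell_inftyP k).1 bk.
have kh E : `|k E| <= c * h E.
  have c0 : 0 <= c by apply: le_trans (kc E).
  have h0 : 0 <= h E by apply: sumr_ge0.
  have [YE|] := boolP (Y `<=` E)%fset.
    by rewrite kY // normr0 mulr_ge0.
  move=> /fsubsetPn[x Yx xE]; apply: (le_trans (kc E)); rewrite ler_peMr //.
  rewrite /h (big_fsetD1 x) //= {1}/misses xE lerDl.
  exact: sumr_ge0.
have [lin _ _] := mm.
have lh d : m (fun E => d * h E + 0 * h E) = 0 by rewrite lin // mh !mulr0 addr0.
have bd d : ell_infty (fun E => d * h E + 0 * h E) by exact: ell_infty_lin.
apply/eqP; rewrite eq_le; apply/andP; split.
- rewrite -(lh c); apply: (le_mean mm) => // E; rewrite mul0r addr0.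
  by apply: le_trans (kh E); exact: ler_norm.
- rewrite -(lh (- c)); apply: (le_mean mm) => // E; rewrite mul0r addr0 mulNr.
  by have := kh E; rewrite ler_norml => /andP[].
Qed.

(** The law of the union of [n] independent [m]-random sets; [fset0] is the
    empty union. *)
Fixpoint union_power (m : ({fset X} -> R) -> R) n (k : {fset X} -> R) : R :=
  if n is n'.+1 then m (fun E => union_power m n' (fun E' => k (E `|` E')%fset))
  else k fset0.

Section UnionPower.
Variable m : ({fset X} -> R) -> R.
Hypotheses (mm : is_mean (@ell_infty R {fset X}) m) (mi : fset_invariant m).

Lemma union_power_mean n : is_mean (@ell_infty R {fset X}) (union_power m n).
Proof.
elim: n => [|n IH]; first exact: mean_dirac.
apply: mean_bind => // E.
exact: mean_push IH (fun k => @ell_infty_comp R _ _ (fun E' => (E `|` E')%fset) k).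
Qed.

Lemma ell_infty_union_power n k : ell_infty k ->
  ell_infty (fun E => union_power m n (fun E' => k (E `|` E')%fset)).
Proof.
move=> /ell_inftyP[c kc].
apply: (ell_infty_mean (M := fun=> union_power m n)) => [_|].
  exact: union_power_mean.
by exists c.
Qed.

Lemma union_power_invariant n : fset_invariant (union_power m n).
Proof.
elim: n => [|n IH] g k bk /=; first by rewrite imfset0.
rewrite -[RHS](mi g) /=; last exact: ell_infty_union_power.
congr m; apply/funext => E; rewrite -[RHS](IH g).
  by congr union_power; apply/funext => E'; rewrite imfsetU.
exact: (ell_infty_comp (fun E' => _ `|` E')%fset bk).
Qed.

(** By independence the probabilities that the copies miss [x] multiply. *)
Lemma union_power_misses n x :
  m (misses x) <= 2^-1 -> union_power m n (misses x) <= 2^-1 ^+ n.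
Proof.
move=> mx; elim: n => [|n IH] /=.
  by rewrite expr0 /misses; case: (_ \notin _).
have [lin pos _] := mm; have [_ posn _] := union_power_mean n.
have bx := ell_infty_misses x.
have u0 : 0 <= union_power m n (misses x) by exact: posn.
rewrite (_ : m _ = union_power m n (misses x) * m (misses x)).
  by rewrite exprSr ler_pM // pos.
have := lin (union_power m n (misses x)) 0 _ _ bx bx.
rewrite mul0r addr0 => <-; congr m; apply/funext => E.
rewrite mul0r addr0 /misses; have [xE|xE] := boolP (x \in E).
  rewrite mulr0 -(mean_cst (union_power_mean n) 0); congr union_power.
  by apply/funext => E'; rewrite in_fsetU xE.
rewrite mulr1; congr union_power; apply/funext => E'.
by rewrite in_fsetU (negbTE xE).
Qed.

(** The bound on [union_power m n] tends to 0 with [n], so the limit mean misses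
    each point with probability 0. *)
Lemma ex_exhausting_mean :
  (forall x, m (misses x) <= 2^-1) -> exists m', exhausting_mean m'.
Proof.
move=> mx; have [L mL Ll] := ex_limit_mean R.
have bp k : ell_infty k -> ell_infty (fun n => union_power m n k).
  by apply: ell_infty_mean1; exact: union_power_mean.
have mm' : is_mean (@ell_infty R {fset X}) (fun k => L (fun n => union_power m n k)).
  by apply: mean_bind => // n; exact: union_power_mean.
exists (fun k => L (fun n => union_power m n k)); apply: exhausting_of_points => //.
  move=> g k bk; congr L; apply/funext => n; exact: union_power_invariant.
move=> x; apply/eqP; rewrite eq_le; apply/andP; split; last first.
  by have [_ pos _] := mm'; apply: pos => //; exact: ell_infty_misses.
apply/ler_addgt0Pr => e e0; rewrite add0r.
apply: Ll; first by apply: bp; exact: ell_infty_misses.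
have := near_infty_natSinv_expn_lt (PosNum e0); apply: filterS => n /ltW /= ne.
apply: le_trans (union_power_misses n (mx x)) _.
by rewrite exprVn -[X in X <= _]div1r.
Qed.

End UnionPower.
End Exhausting.

(** * Extensive amenability through exhausting means *)

Section ExtensivelyAmenable.
Variables (R : realType) (X : choiceType) (G : groupClosed (Sym X)).
Local Notation Z2X := {fsfun X -> 'Z_2 with (1%g : 'Z_2)}.
Implicit Types (E A : {fset X}) (f : Z2X).

Definition indic A : Z2X := [fsfun x in A => (1%R : 'Z_2) | 1%g].

Lemma finsupp_indic A : finsupp (indic A) = A.
Proof. by apply/fsetP => x; rewrite mem_finsupp fsfunE; case: (x \in A). Qed.

(** The group Z/2 has a single nontrivial element, so a function is determined by
    its support. *)
Lemma indicK : cancel (fun f => finsupp f) indic.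
Proof.
move=> f; apply/fsfunP => x; rewrite fsfunE mem_finsupp.
by case: (f x) => -[|[|]] // i /=; exact: val_inj.
Qed.

Lemma finsupp_mul f f' x :
  (x \in finsupp (fsfun_mul f f')) = (x \in finsupp f) (+) (x \in finsupp f').
Proof.
rewrite !mem_finsupp fsfun_mulE.
by case: (f x) => -[|[|]] // ?; case: (f' x) => -[|[|]].
Qed.

Lemma finsupp_shift (g : Sym X) f :
  finsupp (fsfun_shift g f) = (g @` finsupp f)%fset.
Proof. by apply/fsetP => x; rewrite mem_sym_imfset !mem_finsupp fsfun_shiftE. Qed.

Lemma finsupp_inj : injective (fun f => finsupp f).
Proof. exact: can_inj indicK. Qed.

Definition supported E : seq Z2X := [seq indic A | A <- enum_fset (fpowerset E)].

Lemma mem_supported E f : (f \in supported E) = (finsupp f `<=` E)%fset.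
Proof.
rewrite -{1}(indicK f) mem_map ?fpowersetE //.
exact: can_inj finsupp_indic.
Qed.

Lemma supported_uniq E : uniq (supported E).
Proof. by rewrite map_inj_uniq ?fset_uniq //; exact: can_inj finsupp_indic. Qed.

Lemma supported_size E : (0 < size (supported E))%N.
Proof.
have : indic fset0 \in supported E by rewrite mem_supported finsupp_indic fsub0set.
by case: (supported E).
Qed.

Lemma affine_inj f (g : Sym X) :
  injective (fun f' => fsfun_mul f (fsfun_shift g f')).
Proof.
move=> f1 f2 e; apply: finsupp_inj; apply/fsetP => x.
have := congr1 (fun h : Z2X => g x \in finsupp h) e.
by rewrite !finsupp_mul !finsupp_shift !mem_sym_imfset symK => /addbI.
Qed.

(** The affine map maps the functions supported in [E] bijectively onto those
    supported in [gE], because [f] is one of the latter. *)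
Lemma avg_supported (k : Z2X -> R) f (g : Sym X) E :
  (finsupp f `<=` g @` E)%fset ->
  avg (supported E) (fun f' => k (fsfun_mul f (fsfun_shift g f'))) =
  avg (supported (g @` E)%fset) k.
Proof.
move=> fE; apply: avg_inj => [|||y]; do ?exact: supported_uniq.
  exact: affine_inj.
rewrite mem_supported; apply/idP/mapP => [/fsubsetP yE|[f' + ->]].
  (* The support of the preimage of [y]: the symmetric difference of the supports
     of [f] and [y], pulled back by [g]. *)
  pose B := [fset x in E | (g x \in finsupp f) (+) (g x \in finsupp y)]%fset.
  have BE : (B `<=` E)%fset by apply/fsubsetP => x; rewrite !inE => /andP[].
  exists (indic B); first by rewrite mem_supported finsupp_indic.
  apply: finsupp_inj; apply/fsetP => x.
  rewrite finsupp_mul finsupp_shift finsupp_indic mem_sym_imfset !inE /= symVK.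
  rewrite -mem_sym_imfset; case: (boolP (x \in (g @` E)%fset)) => /= xE.
    by rewrite addKb.
  rewrite addbF; move: (fsubsetP fE x) (yE x) => {yE}.
  move: xE; do 3!case: (x \in _) => //=; try (by move=> _ /(_ isT)).
  by move=> _ _ /(_ isT).
rewrite mem_supported => /fsubsetP f'E; apply/fsubsetP => x.
rewrite finsupp_mul finsupp_shift !mem_sym_imfset => h.
case: (boolP (x \in finsupp f)) h => [/(fsubsetP fE)|_ /=]; last exact: f'E.
by rewrite mem_sym_imfset.
Qed.

(** Left to right, toggling the coordinate [x] exchanges the functions whose
    support contains [x] with the others, so each half has measure 1/2. Right to
    left, average over the functions supported in a random finite set. *)
Lemma extensively_amenableP :
  extensively_amenable R (subgroup_incl G) <->
  exists m : ({fset X} -> R) -> R, exhausting_mean G m.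
Proof.
split=> [[mu mmu muT]|[m em]].
  have m0 := mean_push (p := fun f => finsupp f) mmu
    (fun k => @ell_infty_comp R _ _ (fun f => finsupp f) k).
  apply: (ex_exhausting_mean m0) => [g k bk|x] /=.
    rewrite -(muT (fun f => k (finsupp f)) (indic fset0) g); last first.
      exact: (ell_infty_comp (fun f => finsupp f)).
    congr mu; apply/funext => f /=; congr k; apply/fsetP => x.
    by rewrite finsupp_mul finsupp_shift finsupp_indic in_fset0.
  pose a f : R := misses R x (finsupp f).
  have ba : ell_infty a.
    exact: (ell_infty_comp (fun f => finsupp f) (@ell_infty_misses R X x)).
  pose T f := fsfun_mul (indic [fset x]%fset) (fsfun_shift (subgroup_incl G 1%g) f).
  have aT : mu (fun f => a (T f)) = mu a by exact: muT.
  suff : mu a + mu a <= 1 by rewrite /a /=; lra.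
  rewrite -{1}aT -meanD //; last exact: (ell_infty_comp T).
  rewrite -(mean_cst mmu 1); apply: (le_mean mmu).
  - exact: (ell_inftyD (ell_infty_comp T ba) ba).
  - exact: ell_infty_cst.
  move=> f; rewrite /a /T /misses finsupp_mul finsupp_shift finsupp_indic.
  rewrite mem_sym_imfset gmulf1 invg1 sym1 in_fset1 eqxx.
  by case: (x \in _); rewrite ?addr0 ?add0r.
have [mm mi _] := em.
have ms E : is_mean (@ell_infty R Z2X) (avg (supported E)).
  by apply: avg_mean; exact: supported_size.
exists (fun k => m (fun E => avg (supported E) k)); first exact: mean_bind.
move=> k f g bk; pose gG : Sym X := val g.
rewrite -[RHS](mi g); last exact: (ell_infty_mean1 ms bk).
apply: (exhausting_eq (Y := (gG^-1%g @` finsupp f)%fset) em).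
- apply: (ell_infty_mean1 ms).
  exact: (ell_infty_comp (fun f' => fsfun_mul f (fsfun_shift gG f'))).
- exact: (ell_infty_comp (fun E => (gG @` E)%fset) (ell_infty_mean1 ms bk)).
by move=> E; rewrite -sym_imfset_sub => fE; exact: avg_supported.
Qed.

End ExtensivelyAmenable.

(** * Elements of the colimit coming from injections *)

Section Emb.
Variable F : inj_functor.

Section Def.
Variables (Y : finType) (Z : choiceType) (s : Y -> Z).

Definition img : {fset Z} := [fset s y | y : Y]%fset.

Lemma img_map_subproof y : s y \in img.
Proof. by rewrite in_imfset. Qed.

Definition img_map (y : Y) : img := [` img_map_subproof y]%fset.

Hypothesis si : injective s.

Lemma img_map_inj : injective img_map.
Proof. by move=> y z /(congr1 val) /= /si. Qed.

(** The map [F Y -> colim F Z] induced by an injection [s]. It makes it possible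
    to work with one fixed source, such as an ordinal, for all the finite subsets
    of the same cardinality. *)
Definition emb (a : F Y) : colim F Z := colim_in (fmor F img_map_inj a).

Lemma embM : {morph emb : a b / (a * b)%g}.
Proof. by move=> a b; rewrite /emb gmulfM colim_inM. Qed.

(** Any finite set containing the image of [s] may serve to compute [emb]. *)
Lemma embE (E : {fset Z}) (t : Y -> E) (ti : injective t) a :
  (forall y, val (t y) = s y) -> emb a = colim_in (fmor F ti a).
Proof.
move=> ts; have sE : (img `<=` E)%fset.
  by apply/fsubsetP => _ /imfsetP[y _ ->]; rewrite -ts (valP (t y)).
rewrite /emb -(colim_in_incl sE); congr colim_in.
by apply: fmor_tri => y; apply: val_inj; rewrite /= ts.
Qed.

End Def.

Lemma emb_val (Z : choiceType) (E : {fset Z}) (a : F E)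
  (vi : injective (val : E -> Z)) : emb vi a = colim_in a.
Proof.
have ii : injective (@id E) by [].
by rewrite (embE vi ii) // fmor_id.
Qed.

Lemma colim_map_emb (Y : finType) (Z Z' : choiceType) (s : Y -> Z)
    (phi : Z -> Z') (si : injective s) (phi_inj : injective phi)
    (s' : Y -> Z') (si' : injective s') a :
  (forall y, s' y = phi (s y)) ->
  colim_map phi_inj (emb si a) = emb si' a.
Proof.
move=> e; rewrite /emb colim_map_in.
have ti := inj_comp (@fset_restr_inj _ _ _ phi_inj (img s)) (img_map_inj si).
rewrite -(fmor_comp _ _ ti) -(embE si' ti) //.
Qed.

End Emb.

(** * Tightness forces extensive amenability *)

Section Semidirect.
Variables (R : realType) (N : groupType) (G : topGroupType).
Variable tau : aut_action N G.

(** The elements with trivial first component form a neighborhood of the identity,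
    as [N] is discrete, and right multiplication by them fixes the first
    component. *)
Lemma LUCB_fst (k : N -> R) :
  ell_infty k -> LUCB (fun p : semidirect tau => k p.1).
Proof.
move=> bk; split; first exact: (ell_infty_comp (fun p : semidirect tau => p.1) bk).
move=> e e0; exists [set p : semidirect tau | p.1 = 1%g].
  exists ([set 1%g], setT) => /=; last by move=> p [].
  by split; [exact: (@discrete_set1 (discrete_topology N)) | exact: filterT].
move=> [a g] [b h] /= ab.
suff -> : a = b by rewrite subrr normr0 ltW.
have := congr1 (tau g) ab.
rewrite /= -aut_actM -aut_act_comp mulgV aut_act1 aut_act_one.
by move=> /(congr1 (fun x => a * x)%g); rewrite mulgA mulgV mul1g mulg1.
Qed.

(** The first component of [(a, g) (b, h)] depends on [b] but not on [h], so the
    first marginal of a left-invariant mean is invariant under the affine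
    action on [N]. *)
Lemma skew_amenable_mean : skew_amenable R (semidirect tau) ->
  exists2 nu : (N -> R) -> R, is_mean (@ell_infty R N) nu &
    forall k a g, ell_infty k -> nu (fun b => k (a * tau g b)%g) = nu k.
Proof.
move=> [mu mmu mi]; exists (fun k => mu (fun p => k p.1)).
  by apply: (mean_push (p := fun p : semidirect tau => p.1) mmu) => k /LUCB_fst.
move=> k a g bk; exact: (mi (fun p => k p.1) ((a, g) : semidirect tau) (LUCB_fst bk)).
Qed.

End Semidirect.

Section Tight.
Variables (R : realType) (X : choiceType) (G : groupClosed (Sym X)).
Variable F : inj_functor.
Implicit Types (x : X) (u v : colim F X) (g : subgroup G).

Definition avoids x u : Prop := exists w, colim_map (F := F) (@setD1_inj X x) w = u.

Lemma avoids_notin (Y : {fset X}) (a : F Y) x : x \notin Y -> avoids x (colim_in a).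
Proof.
move=> xY; have yx (y : Y) : val y != x.
  by apply: contraNneq xY => <-; exact: valP.
pose t (y : Y) : {y : X | y != x} := exist _ (val y) (yx y).
have ti : injective t by move=> y z /(congr1 val) /= /val_inj.
exists (emb ti a); rewrite (colim_map_emb ti _ val_inj) //.
exact: emb_val.
Qed.

Lemma avoidsM x u v : avoids x u -> avoids x v -> avoids x (u * v)%g.
Proof. by move=> [u' <-] [v' <-]; exists (u' * v')%g; rewrite gmulfM. Qed.

Lemma avoidsV x u : avoids x u -> avoids x u^-1%g.
Proof.
move=> [u' <-]; exists (u'^-1)%g; set f := colim_map _.
have f1 : f 1%g = 1%g by apply: (mulgI (f 1%g)); rewrite -gmulfM !mulg1.
by apply: (mulgI (f u')); rewrite -gmulfM !mulgV.
Qed.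

(** The restriction of [g] is an injection of the complement of [x] into the
    complement of [g x]. *)
Lemma avoids_act g x u : avoids x u -> avoids (val g x) (colim_act g u).
Proof.
move=> [v <-]; have gx (y : {y : X | y != x}) : val g (val y) != val g x.
  by rewrite (inj_eq (@sym_inj X (val g))) (valP y).
pose t (y : {y : X | y != x}) : {y : X | y != val g x} :=
  exist _ (val g (val y)) (gx y).
have ti : injective t by move=> y z /(congr1 val) /= /(@sym_inj X) /val_inj.
exists (colim_map ti v).
have ci : injective (val \o t) by exact: inj_comp.
rewrite -(colim_map_comp _ _ ci) /colim_act.
exact: (colim_map_comp (@setD1_inj X x) (@sym_inj X (val g)) ci).
Qed.

(** The points that [u] genuinely involves: all of them lie in any finite set that
    [u] comes from, whence the finiteness. For a general functor [u] need not come
    from [colim_supp u] itself. *)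
Definition colim_supp u : {fset X} :=
  [fset x in projT1 (cid (colim_inP u)) | ~~ `[< avoids x u >]]%fset.

Lemma mem_colim_supp u x : (x \in colim_supp u) = ~~ `[< avoids x u >].
Proof.
rewrite !inE /=; case: cid => Y [a ua] /=.
case: (boolP (x \in Y)) => //= xY; apply/esym/negbTE; rewrite negbK.
by apply/asboolP; rewrite ua; exact: avoids_notin.
Qed.

Lemma colim_supp_act g u :
  colim_supp (colim_act g u) = (val g @` colim_supp u)%fset.
Proof.
apply/fsetP => x; rewrite mem_sym_imfset !mem_colim_supp; congr (~~ _).
apply/asboolP/asboolP => [/(avoids_act g^-1%g)|/(avoids_act g)].
  by rewrite -colim_act_comp mulVg colim_act1 gmulfV.
by rewrite symVK.
Qed.

(** The elements avoiding [x] form a subgroup, which is proper by tightness. It is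
    disjoint from one of its translates, so an invariant mean gives it at most
    1/2. *)
Lemma tight_exhausting_mean : tight F X ->
  skew_amenable R (semidirect (colim_action F G)) ->
  exists m : ({fset X} -> R) -> R, exhausting_mean G m.
Proof.
move=> Ft /skew_amenable_mean [nu mnu nui].
have m0 := mean_push (p := colim_supp) mnu
  (fun k => @ell_infty_comp R _ _ colim_supp k).
apply: (ex_exhausting_mean m0) => [g k bk|x] /=.
  have bks : ell_infty (fun u => k (colim_supp u)).
    exact: (ell_infty_comp colim_supp).
  rewrite -(nui (fun u => k (colim_supp u)) 1%g g bks).
  by congr nu; apply/funext => u /=; rewrite mul1g colim_supp_act.
have [w wx] : exists w, ~ avoids x w by apply/existsNP => xx; exact: (Ft x).
pose a u : R := misses R x (colim_supp u).
have ba : ell_infty a.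
  exact: (ell_infty_comp colim_supp (@ell_infty_misses R X x)).
have aw : nu (fun u => a (w * colim_act (1%g : subgroup G) u)%g) = nu a.
  exact: (nui a w 1%g ba).
suff : nu a + nu a <= 1 by rewrite /a /=; lra.
have bw := ell_infty_comp (fun u => w * colim_act (1%g : subgroup G) u)%g ba.
rewrite -{1}aw -meanD //.
rewrite -(mean_cst mnu 1); apply: (le_mean mnu).
- exact: (ell_inftyD bw ba).
- exact: ell_infty_cst.
move=> u; rewrite colim_act1 /a /misses !mem_colim_supp !negbK.
case: asboolP => [awu|_]; case: asboolP => [au|_]; rewrite ?addr0 ?add0r //.
by exfalso; apply: wx; rewrite -(mulgK u w); apply: avoidsM => //; exact: avoidsV.
Qed.

End Tight.

(** * Uniform measures on injections *)

Section Injections.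
Variable X : choiceType.
Implicit Types (E : {fset X}) (g : Sym X).

Definition postcomp (Y : finType) g (s : {ffun Y -> X}) : {ffun Y -> X} :=
  [ffun y => g (s y)].

Lemma postcomp_inj (Y : finType) g : injective (@postcomp Y g).
Proof.
move=> s t /ffunP e; apply/ffunP => y; apply: (@sym_inj X g).
by have := e y; rewrite !ffunE.
Qed.

Lemma postcompK (Y : finType) g : cancel (@postcomp Y g^-1%g) (@postcomp Y g).
Proof. by move=> s; apply/ffunP => y; rewrite !ffunE symVK. Qed.

Definition inj_into (Y : finType) E : seq {ffun Y -> X} :=
  [seq [ffun y => val (t y)] |
    t : {ffun Y -> E} <- enum {ffun Y -> E} & injectiveb t].

Lemma inj_into_uniq Y E : uniq (inj_into Y E).
Proof.
rewrite map_inj_uniq; first by apply: filter_uniq; exact: enum_uniq.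
move=> s t /ffunP e.
by apply/ffunP => y; apply: val_inj; have := e y; rewrite !ffunE.
Qed.

Lemma inj_intoP (Y : finType) E (s : {ffun Y -> X}) :
  reflect (injective s /\ forall y, s y \in E) (s \in inj_into Y E).
Proof.
apply: (iffP mapP) => [[t]|[si sE]].
  rewrite mem_filter => /andP[/injectiveP ti _] ->; split=> [y z|y].
    by rewrite !ffunE => /val_inj /ti.
  by rewrite ffunE; exact: valP.
exists [ffun y => [` sE y]%fset]; last by apply/ffunP => y; rewrite !ffunE.
rewrite mem_filter mem_enum andbT; apply/injectiveP => y z.
by rewrite !ffunE => /(congr1 val) /= /si.
Qed.

Lemma postcomp_inj_into (Y : finType) E g (s : {ffun Y -> X}) :
  s \in inj_into Y E -> postcomp g s \in inj_into Y (g @` E)%fset.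
Proof.
move=> /inj_intoP[si sE]; apply/inj_intoP; split=> [y z|y].
  by rewrite !ffunE => /(@sym_inj X) /si.
by rewrite ffunE mem_sym_imfset symK.
Qed.

(** Injections into [gE] are the images under [g] of injections into [E]. *)
Lemma inj_into_postcomp (Y : finType) E g (s : {ffun Y -> X}) :
  (s \in inj_into Y (g @` E)%fset) = (s \in map (postcomp g) (inj_into Y E)).
Proof.
apply/idP/mapP => [sE|[t tE ->]]; last exact: postcomp_inj_into.
exists (postcomp g^-1%g s); last by rewrite postcompK.
have := postcomp_inj_into g^-1%g sE; congr (_ \in inj_into _ _).
by apply/fsetP => x; rewrite !mem_sym_imfset symVK.
Qed.

End Injections.

(** * Equivariant means on the colimit *)

Section ColimMeans.
Variables (R : realType) (X : choiceType) (F : inj_functor).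
Hypothesis F_amenable : forall Y : finType, amenable R (F Y).
Implicit Types (E : {fset X}).

Definition fin_mean (Y : finType) : (F Y -> R) -> R := s2val (cid2 (F_amenable Y)).

Lemma fin_mean_mean Y : is_mean (@ell_infty R (F Y)) (@fin_mean Y).
Proof. exact: s2valP (cid2 (F_amenable Y)). Qed.

Lemma fin_mean_left Y (f : F Y -> R) h :
  ell_infty f -> fin_mean (fun x => f (h * x)%g) = fin_mean f.
Proof. exact: s2valP' (cid2 (F_amenable Y)) f h. Qed.

(** [emb] extended by a junk value, so that [s] can be averaged over without
    carrying the proof that it is injective. *)
Definition total_emb (Y : finType) (s : {ffun Y -> X}) (b : F Y) : colim F X :=
  if pselect (injective s) is left si then emb si b else 1%g.

Lemma total_embE (Y : finType) (s : {ffun Y -> X}) (si : injective s) b :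
  total_emb s b = emb si b.
Proof.
rewrite /total_emb; case: pselect => // si'.
by rewrite (Prop_irrelevance si' si).
Qed.

(** An injection between sets of the same size is a bijection, so it induces an
    isomorphism onto the part of the colimit coming from [E]. *)
Lemma emb_onto (Y : finType) E (s : Y -> X) (si : injective s) (a : F E) :
  #|Y| = #|` E| -> (forall y, s y \in E) -> exists b, colim_in a = emb si b.
Proof.
move=> YE sE; pose t y : E := [` sE y]%fset.
have ti : injective t by move=> y z /(congr1 val) /= /si.
have [|t' tK t'K] := inj_card_bij ti; first by rewrite YE cardfE.
have ii : injective (@id E) by [].
exists (fmor F (can_inj t'K) a); rewrite (embE si ti) //.
by rewrite (fmor_tri _ _ ii) // fmor_id.
Qed.

(** A translation-invariant mean on [F(E)] that depends only on the set [E]: an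
    invariant mean on the value of [F] at the ordinal of the same size is
    transported through all the enumerations of [E], with equal weights. Choosing
    an arbitrary mean for each [E] would lose equivariance. *)
Definition colim_mean E (k : colim F X -> R) : R :=
  avg (inj_into 'I_(#|` E|) E) (fun s => fin_mean (fun b => k (total_emb s b))).

Lemma colim_mean_mean E : is_mean (@ell_infty R (colim F X)) (colim_mean E).
Proof.
apply: (mean_bind (mu := avg (inj_into 'I_(#|` E|) E))) => [|s].
  apply: avg_mean.
  pose s : {ffun 'I_(#|` E|) -> X} :=
    [ffun i => val (enum_val (cast_ord (cardfE E) i))].
  suff : s \in inj_into 'I_(#|` E|) E by case: (inj_into _ _).
  apply/inj_intoP; split=> [i j|i]; rewrite !ffunE; last exact: valP.
  by move=> /val_inj /enum_val_inj /cast_ord_inj.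
exact: (mean_push (fin_mean_mean _) (fun k => @ell_infty_comp R _ _ (total_emb s) k)).
Qed.

(** Each enumeration turns translation by an element of [F(E)] into a translation
    of the source, so each term of the average is invariant. *)
Lemma colim_mean_left (Y E : {fset X}) (a : F Y) k : (Y `<=` E)%fset ->
  ell_infty k -> colim_mean E (fun u => k (colim_in a * u)%g) = colim_mean E k.
Proof.
move=> YE bk; rewrite -(colim_in_incl YE); apply: eq_avg => s /inj_intoP[si sE].
have [b ->] := emb_onto si (fmor_incl F YE a) (card_ord _) sE.
rewrite -[RHS](fin_mean_left b); last exact: (ell_infty_comp (total_emb s)).
by congr fin_mean; apply/funext => c; rewrite !(total_embE si) embM.
Qed.

Lemma colim_mean_act (G : groupClosed (Sym X)) (g : subgroup G) E k :
  colim_mean (val g @` E)%fset k = colim_mean E (fun u => k (colim_act g u)).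
Proof.
rewrite /colim_mean card_imfset /=; last exact: sym_inj.
set n := #|` E|.
rewrite -(avg_inj (s := inj_into 'I_n E) (h := @postcomp X 'I_n (val g))); first last.
- by move=> s; exact: inj_into_postcomp.
- exact: postcomp_inj.
- exact: inj_into_uniq.
- exact: inj_into_uniq.
apply: eq_avg => s sE; have /inj_intoP[si _] := sE.
have /inj_intoP[gsi _] := postcomp_inj_into (val g) sE.
congr fin_mean; apply/funext => b; congr k.
rewrite (total_embE si) (total_embE gsi) /colim_act (colim_map_emb _ _ gsi) // => y.
by rewrite ffunE.
Qed.

End ColimMeans.

(** * Extensive amenability forces skew-amenability *)

Section SkewAmenable.
Variables (R : realType) (X : choiceType) (G : groupClosed (Sym X)).
Variable F : inj_functor.
Hypothesis F_amenable : forall Y : finType, amenable R (F Y).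
Implicit Types (E D Y : {fset X}) (g : subgroup G).
Local Notation NG := (semidirect (colim_action F G)).

(** The pointwise stabilizers of the finite sets form a filter base, and the
    filter they generate converges to the identity: pointwise convergence of
    permutations means eventual constancy at each point. *)
Lemma nbhs_fixator (V : set (subgroup G)) : nbhs (1%g : subgroup G) V ->
  exists D, forall g, (forall x, x \in D -> val g x = x) -> V g.
Proof.
pose fixator D : set (subgroup G) :=
  [set g : subgroup G | forall x, x \in D -> val g x = x].
pose B : set_system (subgroup G) := filter_from [set: {fset X}] fixator.
have FB : Filter B.
  apply: filter_from_filter; first by exists fset0.
  move=> D D' _ _; exists (D `|` D')%fset => // g gD.
  by split=> x xD; apply: gD; rewrite in_fsetU xD ?orbT.
suff : B --> (1%g : subgroup G).
  by move=> BV /BV[D _ DV]; exists D => g gD; exact: DV.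
apply/cvg_initial/cvg_sym => x; exists [fset x]%fset => // g gx.
by apply: gx; rewrite in_fset1.
Qed.

(** Uniform continuity over cosets of stabilizers: [g] and [h] agree on [D] exactly
    when they differ on the right by an element fixing [D] pointwise. *)
Lemma LUCB_fixator (f : NG -> R) e : LUCB f -> 0 < e ->
  exists D, forall a (g h : subgroup G), (forall x, x \in D -> val g x = val h x) ->
    `|f (a, g) - f (a, h)| <= e.
Proof.
move=> [_ fu] /fu[U [[A V] /= [A1 V1] AVU] fU].
have [D DV] := nbhs_fixator V1.
exists D => a g h gh; apply: fU; apply: AVU; split => /=.
  rewrite -colim_actM mulVg [colim_act _ _](aut_act_one (colim_action F G)).
  exact: (@nbhs_singleton (discrete_topology (colim F X))).
apply: DV => x xD; rewrite gmulfM symM -gh // gmulfV.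
exact: symK.
Qed.

Definition restr D g : {ffun D -> X} := [ffun y => val g (val y)].

(** A chosen representative of the coset of the pointwise stabilizer of [D] that
    [s] stands for; the value at maps that are not restrictions is junk. *)
Definition extension D (s : {ffun D -> X}) : subgroup G :=
  if pselect (exists g, restr D g = s) is left e then projT1 (cid e) else 1%g.

Lemma restr_extension D (s : {ffun D -> X}) :
  (exists g, restr D g = s) -> restr D (extension s) = s.
Proof. by rewrite /extension; case: pselect => // e _; case: cid. Qed.

(** The finite set of cosets [g G_D] with [gD] contained in [E], where [G_D] is
    the pointwise stabilizer of [D]; a coset is recorded by its restriction
    to [D]. *)
Definition translates D E : seq {ffun D -> X} :=
  [seq s <- inj_into D E | `[< exists g, restr D g = s >]].

Lemma postcomp_restr D (g h : subgroup G) :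
  postcomp (val g) (restr D h) = restr D (g * h)%g.
Proof. by apply/ffunP => y; rewrite !ffunE. Qed.

Lemma translates_postcomp D E g s :
  (s \in translates D (val g @` E)%fset) =
  (s \in map (postcomp (val g)) (translates D E)).
Proof.
rewrite mem_filter inj_into_postcomp; apply/andP/mapP.
  move=> [/asboolP[h hs] /mapP[t tE st]]; exists t => //.
  rewrite mem_filter tE andbT; apply/asboolP; exists (g^-1 * h)%g.
  apply: (@postcomp_inj _ _ (val g)).
  by rewrite postcomp_restr mulgA mulgV mul1g hs.
move=> [t]; rewrite mem_filter => /andP[/asboolP[h ht] tE] ->.
split; last exact: map_f.
by apply/asboolP; exists (g * h)%g; rewrite -postcomp_restr ht.
Qed.

Lemma translates_size D E : (D `<=` E)%fset -> (0 < size (translates D E))%N.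
Proof.
move=> /fsubsetP DE; suff : restr D 1%g \in translates D E by case: (translates _ _).
rewrite mem_filter; apply/andP; split; first by apply/asboolP; exists 1%g.
by apply/inj_intoP; split=> [y z|y]; rewrite !ffunE; [exact: val_inj | exact/DE/valP].
Qed.

(** A uniform measure needs a nonempty list. The default is used only for the
    [E] not containing [D], which an exhausting mean ignores. *)
Definition sample D E : seq {ffun D -> X} :=
  if translates D E is [::] then [:: restr D 1%g] else translates D E.

Lemma sampleE D E : (D `<=` E)%fset -> sample D E = translates D E.
Proof. by rewrite /sample => /translates_size; case: (translates D E). Qed.

Definition pair_mean D E (f : NG -> R) : R :=
  avg (sample D E)
    (fun s => colim_mean F_amenable E (fun u => f (u, extension s))).

Lemma pair_mean_mean D E : is_mean (@ell_infty R NG) (pair_mean D E).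
Proof.
apply: (mean_bind (mu := avg (sample D E))) => [|s].
  by apply: avg_mean; rewrite /sample; case E0: (translates D E).
exact: (mean_push (colim_mean_mean F_amenable E)
  (fun k => @ell_infty_comp R _ _ (fun u => (u, extension s) : NG) k)).
Qed.

(** Reindexing the coset average by [g], and using that [a] comes from [F(gE)] to
    absorb it, turns the mean at [gE] into an average over the same index set
    as the translated mean at [E]. The two integrands then differ only in the
    representative of a coset: [g * extension s] against the extension of
    [g s]. *)
Lemma pair_mean_postcomp D Y E (a : F Y) g (f : NG -> R) e :
  ell_infty f -> (D `<=` E)%fset -> (D `<=` val g @` E)%fset ->
  (Y `<=` val g @` E)%fset ->
  (forall u (h h' : subgroup G), (forall x, x \in D -> val h x = val h' x) ->
    `|f (u, h) - f (u, h')| <= e) ->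
  `|pair_mean D E (fun p => f (((colim_in a, g) : NG) * p)%g) -
    pair_mean D (val g @` E)%fset f| <= e.
Proof.
move=> bf DE DgE YgE fe; rewrite /pair_mean !sampleE //.
rewrite -(avg_inj (s := translates D E) (t := translates D (val g @` E)%fset)
  (h := postcomp (val g))); first last.
- by move=> s; exact: translates_postcomp.
- exact: postcomp_inj.
- by apply: filter_uniq; exact: inj_into_uniq.
- by apply: filter_uniq; exact: inj_into_uniq.
apply: avg_close; first exact: translates_size.
move=> s; rewrite mem_filter => /andP[/asboolP sG sE].
have bfl (h : subgroup G) : ell_infty (fun u => f (u, h)).
  exact: (ell_infty_comp (fun u => (u, h) : NG)).
rewrite -[X in _ - X](colim_mean_left F_amenable a YgE (bfl _)) colim_mean_act.
rewrite -(meanB (colim_mean_mean F_amenable E)); first last.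
- exact: (ell_infty_comp (fun u =>
    (colim_in a * colim_act g u, extension (postcomp (val g) s))%g : NG)).
- exact: (ell_infty_comp (fun u =>
    ((colim_in a, g) : NG) * ((u, extension s) : NG))%g).
apply: (le_norm_mean (colim_mean_mean F_amenable E)) => u.
apply: fe => x xD.
have : restr D (g * extension s)%g = restr D (extension (postcomp (val g) s)).
  rewrite -postcomp_restr !restr_extension //.
  by have [h hs] := sG; exists (g * h)%g; rewrite -postcomp_restr hs.
by move=> /ffunP /(_ [` xD]%fset); rewrite !ffunE.
Qed.

(** The set [D] must be large enough for [f] to be nearly constant on cosets of
    its pointwise stabilizer, and [E] large enough for [E] and [gE] to contain
    [D] and for [gE] to support [a]. Since [m] is exhausting both hold almost
    surely, so translating [f] changes the mean by at most [e]. *)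
Lemma skew_amenable_of_exhausting (m : ({fset X} -> R) -> R) :
  exhausting_mean G m -> skew_amenable R NG.
Proof.
move=> em; have [mm mi _] := em.
have mD D : is_mean (@ell_infty R NG) (fun f => m (fun E => pair_mean D E f)).
  by apply: mean_bind => // E; exact: pair_mean_mean.
pose mu f := m (fun D => m (fun E => pair_mean D E f)).
have [lin pos one] : is_mean (@ell_infty R NG) mu by exact: mean_bind.
exists mu.
  split=> // [a b f h [bf _] [bh _]|f [bf _]]; [exact: lin | exact: pos].
move=> f [a g] Lf; have [bf _] := Lf.
have [Y [a0 ->]] := colim_inP a.
have bfg : ell_infty (fun p => f (((colim_in a0, g) : NG) * p)%g).
  exact: (ell_infty_comp (fun p : NG => ((colim_in a0, g) : NG) * p)%g).
apply/eqP; rewrite -subr_eq0 -normr_le0.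
apply/ler_addgt0Pr => e e0; rewrite add0r.
have [D0 D0f] := LUCB_fixator Lf e0.
apply: (exhausting_close (Y := D0) em) => //; [| |exact: ltW|].
- exact: (ell_infty_mean1 mD bfg).
- exact: (ell_infty_mean1 mD bf).
move=> D D0D.
have bp h : ell_infty h -> ell_infty (fun E => pair_mean D E h).
  exact: (ell_infty_mean1 (pair_mean_mean D)).
rewrite -(mi g (fun E => pair_mean D E f) (bp _ bf)).
apply: (exhausting_close
  (Y := (D `|` (val g)^-1%g @` (D `|` Y))%fset) em) => //; [| |exact: ltW|].
- exact: bp.
- exact: (ell_infty_comp (fun E => (val g @` E)%fset) (bp _ bf)).
move=> E; rewrite fsubUset -sym_imfset_sub fsubUset => /and3P[DE DgE YgE].
apply: pair_mean_postcomp => // u h h' hh'; apply: D0f => x xD0.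
exact/hh'/(fsubsetP D0D).
Qed.

End SkewAmenable.

Theorem theorem4p5 (R : realType) (X : choiceType)
    (G : groupClosed (Sym X)) (F : inj_functor)
    (F_amenable : forall Y : finType, amenable R (F Y)) :
  (extensively_amenable R (subgroup_incl G) ->
   skew_amenable R (semidirect (colim_action F G))) /\
  (tight F X ->
   skew_amenable R (semidirect (colim_action F G)) ->
   extensively_amenable R (subgroup_incl G)).
Proof.
split=> [/extensively_amenableP[m em]|Ft sa].
  exact: skew_amenable_of_exhausting em.
by apply/extensively_amenableP; exact: tight_exhausting_mean sa.
Qed.
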